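(* Let $u:\mathbb{N}\to\mathbb{T}$ and assume that for every $\alpha\in\mathbb{Q}$ the sequence $n\mapsto u(n)+n\alpha$ is uniformly distributed in $\mathbb{T}$. Let $(n_k)_{k\in\mathbb{N}}$ be a rational Besicovitch sequence. Then the sequence $k\mapsto u(n_k)$ is uniformly distributed in $\mathbb{T}$.
   Context: $\mathbb{N}=\{1,2,\dots\}$; $\mathbb{T}=\mathbb{R}/\mathbb{Z}$ is identified with $[0,1)$. A sequence $(x_n)$ in $\mathbb{T}$ is uniformly distributed if $\lim_{N\to\infty}\frac1N|\{1\le n\le N:x_n\in[a,b)\}|=b-a$ for all $0\le a<b\le1$. A function $f:\mathbb{N}\to\mathbb{C}$ is rational Besicovitch almost periodic if for every $\epsilon>0$ there exist $k\in\mathbb{N}$, $\alpha_1,\dots,\alpha_k\in\mathbb{Q}$ and $c_1,\dots,c_k\in\mathbb{C}$ such that $\limsup_{N\to\infty}\frac1N\sum_{n=1}^N\big|f(n)-\sum_{j=1}^kc_je^{2\pi i\alpha_jn}\big|<\epsilon$. An increasing sequence $(n_k)_{k\in\mathbb{N}}$ in $\mathbb{N}$ is a rational Besicovitch sequence if the indicator function of $A=\{n_k:k\in\mathbb{N}\}$ is rational Besicovitch almost periodic and $A$ has positive upper density $\limsup_{N\to\infty}|A\cap\{1,\dots,N\}|/N>0$. *)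

(* Defs.v *)
From HB Require Import structures.
From mathcomp Require Import all_boot all_order all_algebra.
From mathcomp Require Import complex ring.
From mathcomp Require Import all_classical all_reals all_analysis.

Set Implicit Arguments.
Unset Strict Implicit.
Unset Printing Implicit Defensive.

Import Order.TTheory GRing.Theory Num.Theory.
Import numFieldNormedType.Exports.
Local Open Scope classical_set_scope.
Local Open Scope ring_scope.

(* The index set is {1, 2, ...}: a function or sequence on it is encoded as a
   function on nat, whose value at 0 is never used. *)

(* R/Z, each class being represented by its element of [0, 1). *)
Definition circle (R : realType) := {x : R | 0 <= x < 1}.

HB.instance Definition _ (R : realType) := Choice.on (circle R).

Section CircleGroup.
Variable R : realType.

Lemma fract_itv (x : R) : 0 <= x - (Num.floor x)%:~R < 1.
Proof.
have /andP[h1 h2] := floor_itv x.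
by rewrite subr_ge0 h1 /= ltrBlDr addrC -[1]/(1%:~R) -intrD.
Qed.

(* The canonical projection R -> R/Z. *)
Definition to_circle (x : R) : circle R := exist _ (x - (Num.floor x)%:~R) (fract_itv x).

Lemma to_circleP (x y : R) :
  reflect (exists m : int, x = y + m%:~R) (to_circle x == to_circle y).
Proof.
apply: (iffP eqP) => [/(congr1 sval) /= h|[m ->]].
  by exists (Num.floor x - Num.floor y); rewrite intrB addrCA -h addrC subrK.
apply: val_inj => /=; rewrite floorDrz ?intr_int // intrKfloor intrD.
by rewrite opprD addrACA subrr addr0.
Qed.

Lemma to_circleK (x : circle R) : to_circle (sval x) = x.
Proof.
case: x => x hx; apply: val_inj => /=.
by rewrite (@floor_def _ x 0) ?subr0.
Qed.

Lemma sval_to_circle (x : R) :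
  sval (to_circle x) = x + (- Num.floor x)%:~R.
Proof. by rewrite intrN. Qed.

Definition circle_add (x y : circle R) := to_circle (sval x + sval y).
Definition circle_opp (x : circle R) := to_circle (- sval x).

Lemma circle_addA : associative circle_add.
Proof.
move=> x y z; apply/eqP/to_circleP; rewrite !sval_to_circle.
exists (Num.floor (sval x + sval y) - Num.floor (sval y + sval z)).
by rewrite intrB !intrN; ring.
Qed.

Lemma circle_addC : commutative circle_add.
Proof. by move=> x y; rewrite /circle_add addrC. Qed.

Lemma circle_add0 : left_id (to_circle 0) circle_add.
Proof. by move=> x; rewrite /circle_add /= floor0 subr0 add0r to_circleK. Qed.

Lemma circle_addN : left_inverse (to_circle 0) circle_opp circle_add.
Proof.
move=> x; apply/eqP/to_circleP; rewrite sval_to_circle.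
by exists (- Num.floor (- sval x)); rewrite add0r addrAC addNr add0r.
Qed.

HB.instance Definition _ := GRing.isZmodule.Build (circle R)
  circle_addA circle_addC circle_add0 circle_addN.

End CircleGroup.

(* |{1 <= n <= N : P n}| *)
Definition count_upto (P : pred nat) (N : nat) : nat := count P (iota 1 N).

Definition uniformly_distributed (R : realType) (x : nat -> circle R) : Prop :=
  forall a b : R, 0 <= a -> a < b -> b <= 1 ->
    (fun N : nat => (count_upto (fun n => a <= sval (x n) < b) N)%:R / N%:R : R)
      @ \oo --> b - a.

(* e^{it} *)
Definition expi (R : realType) (t : R) : R[i] := (cos t +i* sin t)%C.

Definition rational_trig_poly (R : realType) (k : nat) (c : 'I_k -> R[i])
    (alpha : 'I_k -> rat) (n : nat) : R[i] :=
  \sum_(j < k) c j * expi (2 * pi * ratr (alpha j) * n%:R).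

Definition rational_Besicovitch_ap (R : realType) (f : nat -> R[i]) : Prop :=
  forall eps : R, 0 < eps ->
    exists k : nat, (0 < k)%N /\
    exists (alpha : 'I_k -> rat) (c : 'I_k -> R[i]),
      (limn_esup (fun N : nat =>
         ((\sum_(1 <= n < N.+1)
             Normc.normc (f n - rational_trig_poly c alpha n)) / N%:R)%:E)
       < eps%:E)%E.

Definition upper_density (R : realType) (A : set nat) : \bar R :=
  limn_esup (fun N : nat => ((count_upto (mem A) N)%:R / N%:R)%:E).

Definition seq_range (nk : nat -> nat) : set nat :=
  [set nk k | k in [set k | (0 < k)%N]].

Definition rational_Besicovitch_seq (R : realType) (nk : nat -> nat) : Prop :=
  [/\ forall k, (0 < k)%N -> (0 < nk k)%N,
      forall j k, (0 < j)%N -> (j < k)%N -> (nk j < nk k)%N,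
      rational_Besicovitch_ap (fun n => (\1_(seq_range nk) n : R)%:C%C)
    & (0 < upper_density R (seq_range nk))%E].

(* Main.v *)
Require Import Defs.
From mathcomp Require Import all_boot all_order all_algebra.
From mathcomp Require Import complex ring lra.
From mathcomp Require Import all_classical all_reals all_analysis.

Set Implicit Arguments.
Unset Strict Implicit.
Unset Printing Implicit Defensive.

Import Order.TTheory GRing.Theory Num.Theory.
Import numFieldNormedType.Exports.
Local Open Scope classical_set_scope.
Local Open Scope ring_scope.

(** Write [mean f N] for the average of f over 1 <= n <= N.  The proof goes
    through Weyl's criterion, in real form: a sequence x in R/Z is uniformly
    distributed iff, for every h >= 1 and every phase phi, the averages of
    cos (2 pi h x_n + phi) tend to 0 ([weyl_necessary], [weyl_sufficient]).

    Let A be the range of (n_k) and h >= 1.  For a rational q, the hypothesis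
    for alpha = q / h says that u(n) + n q / h is uniformly distributed, so by
    the criterion cos (2 pi h u(n) + 2 pi q n + phi) has mean value 0
    ([cvg_mean_twisted]).  Hence g(n) = cos (2 pi h u(n) + phi) has mean
    value 0 against every finite sum of cosines with rational frequencies, and,
    since the indicator of A is approximated in mean by such sums, also against
    the indicator of A ([cvg_mean_mul_approximable]).

    The average of g over n_1, ..., n_K is the average of g * 1_A up to n_K
    divided by the density of A up to n_K ([cvg_mean_subseq]), so the density
    has to stay away from 0 along the whole sequence, whereas only the upper
    density is known to be positive.  But a finite sum of cosines has a mean
    value, so the densities of A oscillate, in the limit, by an arbitrarily
    small amount, and a positive upper density forces a positive lower density
    ([mean_eventually_ge]).  The criterion applied to u(n_k) concludes.

    The sufficient half of the criterion needs a trigonometric majorant of the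
    indicator of an arc.  It is a discrete convolution of the kernel
    ((1 + cos t) / 2)^m with an arc of the grid of step 1 / (m + 1): on m + 1
    equidistant points the kernel, of degree m, sums exactly to m + 1 times its
    constant coefficient, and away from 0 it is exponentially small in m.
    Majorants suffice, because the circle is the union of an arc and its
    complement ([weyl_arc_upper]). *)

(** * Averages *)

Section Mean.
Variable R : realType.
Implicit Types f g : nat -> R.

Definition mean f (N : nat) : R := (\sum_(1 <= n < N.+1) f n) / N%:R.

Lemma eq_mean f g : (forall n, (0 < n)%N -> f n = g n) -> mean f = mean g.
Proof.
move=> fg; apply/funext => N; rewrite /mean; congr (_ / _).
by rewrite !big_nat; apply: eq_bigr => i /andP[i0 _]; apply: fg.
Qed.

Lemma meanD f g : mean (fun n => f n + g n) = (fun N => mean f N + mean g N).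
Proof. by apply/funext => N; rewrite /mean big_split mulrDl. Qed.

Lemma meanZ (a : R) f : mean (fun n => a * f n) = (fun N => a * mean f N).
Proof. by apply/funext => N; rewrite /mean -mulr_sumr mulrA. Qed.

Lemma meanB f g : mean (fun n => f n - g n) = (fun N => mean f N - mean g N).
Proof. by apply/funext => N; rewrite /mean sumrB mulrBl. Qed.

Lemma mean_sum (I : finType) (P : pred I) (f : I -> nat -> R) :
  mean (fun n => \sum_(i | P i) f i n) = (fun N => \sum_(i | P i) mean (f i) N).
Proof. by apply/funext => N; rewrite /mean exchange_big/= mulr_suml. Qed.

Lemma ler_mean f g N :
  (forall n, (0 < n)%N -> f n <= g n) -> mean f N <= mean g N.
Proof.
move=> fg; rewrite /mean ler_wpM2r ?invr_ge0// !big_nat.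
by apply: ler_sum => i /andP[i0 _]; apply: fg.
Qed.

Lemma mean_cst (c : R) N : (0 < N)%N -> mean (fun=> c) N = c.
Proof.
move=> N0; rewrite /mean sumr_const_nat subn1/= -[c *+ N]mulr_natr mulfK//.
by rewrite pnatr_eq0 -lt0n.
Qed.

Lemma ler_norm_mean f N : `|mean f N| <= mean (fun n => `|f n|) N.
Proof.
rewrite /mean normrM [`|_^-1|]ger0_norm ?invr_ge0// ler_wpM2r ?invr_ge0//.
exact: ler_norm_sum.
Qed.

Lemma cvg_sum_fin (I : finType) (P : pred I) (f : I -> nat -> R) (l : I -> R) :
  (forall i, P i -> f i @ \oo --> l i) ->
  (fun N => \sum_(i | P i) f i N) @ \oo --> \sum_(i | P i) l i.
Proof.
by move=> h; apply: cvg_big => //; exact: add_continuous.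
Qed.

Lemma cvg_mean_cst (c : R) : mean (fun=> c) @ \oo --> c.
Proof.
apply: cvg_near_cst; exists 1%N => // N /= N1.
by rewrite mean_cst.
Qed.

(** The sequences with mean value 0 are closed for the seminorm
    limsup (mean |f|), the one that defines Besicovitch almost periodicity. *)
Lemma cvg_mean_approx f :
  (forall e : R, 0 < e -> exists g, mean g @ \oo --> (0 : R) /\
     \forall N \near \oo, mean (fun n => `|f n - g n|) N <= e) ->
  mean f @ \oo --> (0 : R).
Proof.
move=> h; apply/cvgrPdist_le => e e0.
have [|g [g0 fg]] := h (e / 2); first by rewrite divr_gt0.
near=> N.
have fgN : mean (fun n => `|f n - g n|) N <= e / 2 by near: N.
have gN : `|0 - mean g N| <= e / 2.
  by near: N; move/cvgrPdist_le : g0; apply; rewrite divr_gt0.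
have := le_trans (ler_norm_mean (fun n => f n - g n) N) fgN.
rewrite meanB /=; move: gN; rewrite !sub0r !normrN => gN.
move=> fgN'; rewrite -[mean f N](subrK (mean g N)).
by apply: (le_trans (ler_normD _ _)); lra.
Unshelve. all: by end_near. Qed.

Lemma cvg_mean_bounded_sums f (C : R) :
  (forall N, `|\sum_(1 <= n < N.+1) f n| <= C) -> mean f @ \oo --> (0 : R).
Proof.
move=> h; apply/norm_cvg0P.
apply: (@squeeze_cvgr _ _ _ _ (fun=> 0) (fun N => C * N%:R^-1)).
- near=> N; rewrite normr_ge0/= /mean normrM [`|_^-1|]ger0_norm ?invr_ge0//.
  by rewrite ler_wpM2r ?invr_ge0.
- exact: cvg_cst.
- rewrite -[X in _ --> X](mulr0 C); apply: cvgMl_tmp.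
  apply/gtr0_cvgV0; last exact: cvgr_idn.
  by near=> N; rewrite ltr0n; near: N; exists 1%N.
Unshelve. all: by end_near. Qed.

End Mean.

(** * Trigonometric sums over arithmetic progressions *)

Section Trigonometry.
Variable R : realType.
Implicit Types x y t s phi : R.

Lemma cosM2 x y : 2 * cos x * cos y = cos (x + y) + cos (x - y).
Proof. by rewrite cosD cosB; ring. Qed.

Lemma cosDnat x n : cos (x + 2 * pi * n%:R) = cos x.
Proof.
have := periodicn (@cosD2pi R) n x.
by rewrite -[(pi *+ 2) *+ n]mulr_natr -[pi *+ 2]mulr_natl => ->.
Qed.

Lemma sinDnat x n : sin (x + 2 * pi * n%:R) = sin x.
Proof.
have := periodicn (@sinD2pi R) n x.
by rewrite -[(pi *+ 2) *+ n]mulr_natr -[pi *+ 2]mulr_natl => ->.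
Qed.

Lemma cosDint x (m : int) : cos (x + 2 * pi * m%:~R) = cos x.
Proof.
case: m => n; first exact: cosDnat.
by rewrite NegzE mulrNz mulrN -[LHS](cosDnat _ n.+1) subrK.
Qed.

Lemma cos_lipschitz x y : `|cos x - cos y| <= `|x - y|.
Proof.
wlog yx : x y / y <= x.
  move=> h; have [/h//|/ltW/h] := leP y x.
  by rewrite distrC [X in _ <= X]distrC.
have [|c _ ->] := @MVT_segment R cos (fun x => - sin x) y x yx
    (fun z _ => is_derive_cos z).
  by apply: continuous_subspaceT; exact: continuous_cos.
by rewrite normrM normrN ler_piMl// sin_max.
Qed.

(** Multiplication by 2 sin t makes the sum telescope. *)
Lemma sum_cos_arith t phi m n : (m <= n)%N ->
  2 * sin t * (\sum_(m <= i < n) cos (2 * t * i%:R + phi)) =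
  sin (2 * t * n%:R - t + phi) - sin (2 * t * m%:R - t + phi).
Proof.
move=> mn; rewrite mulr_sumr.
rewrite -(telescope_sumr (fun i => sin (2 * t * i%:R - t + phi)) mn).
apply: eq_bigr => i _.
rewrite (_ : 2 * t * i.+1%:R - t + phi = (2 * t * i%:R + phi) + t); last first.
  by rewrite -natr1; ring.
rewrite (_ : 2 * t * i%:R - t + phi = (2 * t * i%:R + phi) - t); last by ring.
by rewrite sinD sinB; ring.
Qed.

(** The nontrivial characters of Z/M sum to 0. *)
Lemma sum_cos_roots (M h : nat) phi : (0 < h < M)%N ->
  \sum_(0 <= i < M) cos (2 * pi * h%:R / M%:R * i%:R + phi) = 0.
Proof.
move=> /andP[h0 hM].
have M0 : 0 < M%:R :> R by rewrite ltr0n (leq_trans _ hM).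
pose t := pi * h%:R / M%:R : R.
have st : 0 < sin t.
  apply: sin_gt0_pi; rewrite /t divr_gt0 ?mulr_gt0 ?pi_gt0 ?ltr0n//=;
    last exact: leq_trans hM.
  by rewrite ltr_pdivrMr// ltr_pM2l ?pi_gt0// ltr_nat.
have := @sum_cos_arith t phi 0 M (leq0n _).
rewrite (_ : 2 * t * M%:R - t + phi = 2 * t * 0%:R - t + phi + 2 * pi * h%:R).
  rewrite sinDnat subrr => /eqP; rewrite !mulf_eq0 pnatr_eq0/= (gt_eqF st)/=.
  move=> /eqP {2}<-; apply: eq_bigr => i _; congr cos.
  by rewrite /t; ring.
by rewrite /t; field; rewrite gt_eqF.
Qed.

(** The partial sums are bounded, so that the mean value is 0, unless t is a
    multiple of 2 pi, in which case the sequence is constant. *)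
Lemma is_cvg_mean_cos t phi : cvgn (mean (fun n => cos (t * n%:R + phi))).
Proof.
have [s0|s0] := eqVneq (sin (t / 2)) 0.
  rewrite (@eq_mean _ _ (fun=> cos phi)); first exact/cvgP/cvg_mean_cst.
  move=> n _; elim: n => [|n <-]; first by rewrite mulr0 add0r.
  rewrite (_ : t * n.+1%:R + phi = (t * n%:R + phi) + (t / 2) *+ 2); last first.
    by rewrite -natr1 -mulr_natr; field.
  by rewrite cosD sin_mulr2n cos_mulr2n s0 cos2sin2 s0; ring.
apply/cvgP/(@cvg_mean_bounded_sums _ _ (`|sin (t / 2)|^-1)) => N.
rewrite -[leRHS]mulr1 ler_pdivlMl ?normr_gt0//.
have := @sum_cos_arith (t / 2) phi 1 N.+1 isT.
rewrite [2 * (t / 2)](_ : _ = t); last by field.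
move=> /(congr1 Num.norm); rewrite !normrM (ger0_norm (ler0n _ 2)) => e.
have := le_trans (ler_normB (sin (t * N.+1%:R - t / 2 + phi))
  (sin (t * 1 - t / 2 + phi))) (lerD (sin_max _) (sin_max _)).
by rewrite -e -mulrA; lra.
Qed.

End Trigonometry.

(** * Weyl's criterion: necessity *)

Section Arcs.
Variable R : realType.
Implicit Types (a b y t phi : R).

Definition arc a b y : R := (a <= y < b)%R%:R.

Lemma arcE a b y : a <= b -> arc a b y = (y < b)%R%:R - (y < a)%R%:R.
Proof.
move=> ab; rewrite /arc (leNgt a).
have [ya|] := ltP y a; first by rewrite (lt_le_trans ya ab) subrr.
by rewrite subr0.
Qed.

Lemma mean_count_upto (P : pred nat) N :
  (count_upto P N)%:R / N%:R = mean (fun n => (P n)%:R : R) N.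
Proof.
rewrite /mean /count_upto -sum1_count /index_iota subn1 big_mkcond/= natr_sum.
by congr (_ / _); apply: eq_bigr => i _; case: (P i).
Qed.

Lemma sum_arc M y : (0 < M)%N -> 0 <= y < 1 ->
  \sum_(j < M) arc (j%:R / M%:R) (j.+1%:R / M%:R) y = 1.
Proof.
move=> M0 /andP[y0 y1].
pose F j : R := (y < j%:R / M%:R)%R%:R.
rewrite (eq_bigr (fun j : 'I_M => F j.+1 - F j)); last first.
  by move=> j _; rewrite arcE// ler_wpM2r ?invr_ge0// ler_nat.
rewrite -(big_mkord xpredT (fun j => F j.+1 - F j)) telescope_sumr// /F.
by rewrite mul0r (ltNge y 0) y0 divff ?y1 ?subr0// pnatr_eq0 -lt0n.
Qed.

(** The cosine is uniformly close to a step function on the M arcs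
    [j/M, (j+1)/M); uniform distribution gives each arc the weight 1/M, and the
    values of the cosine at the points j/M sum to 0 as soon as h < M. *)
Lemma weyl_necessary (x : nat -> circle R) (h : nat) phi :
  uniformly_distributed x -> (0 < h)%N ->
  mean (fun n => cos (2 * pi * h%:R * sval (x n) + phi)) @ \oo --> (0 : R).
Proof.
move=> xud h0; apply: cvg_mean_approx => e e0.
pose w : R := 2 * pi * h%:R.
have w0 : 0 < w by rewrite !mulr_gt0 ?pi_gt0 ?ltr0n.
(* M exceeds h, so that the sum over the grid vanishes, and w / e, so that the
   cosine varies by at most e on an arc of length 1/M. *)
pose M := (Num.truncn (w / e) + h).+1.
have hM : (h < M)%N by rewrite /M ltnS leq_addl.
have M0 : 0 < M%:R :> R by rewrite ltr0n.
have wM : w / M%:R <= e.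
  rewrite ler_pdivrMr// mulrC -ler_pdivrMr//.
  apply: ltW; apply: lt_le_trans (truncnS_gt _) _.
  by rewrite ler_nat ltnS leq_addr.
pose cj (j : nat) := cos (w * (j%:R / M%:R) + phi).
pose A (j : nat) (n : nat) := arc (j%:R / M%:R) (j.+1%:R / M%:R) (sval (x n)).
exists (fun n => \sum_(j < M) cj j * A j n); split.
  rewrite mean_sum.
  rewrite [X in _ --> X](_ : 0 = \sum_(j < M) cj j * M%:R^-1); last first.
    rewrite -mulr_suml -(big_mkord xpredT cj).
    rewrite (eq_bigr (fun i : nat => cos (2 * pi * h%:R / M%:R * i%:R + phi))).
      by rewrite sum_cos_roots ?mul0r// h0.
    by move=> i _; rewrite /cj /w; congr cos; ring.
  apply: cvg_sum_fin => j _; rewrite meanZ; apply: cvgMl_tmp.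
  have -> : M%:R^-1 = j.+1%:R / M%:R - j%:R / M%:R :> R.
    by rewrite -mulrBl -natrB// subSnn mul1r.
  rewrite (_ : mean _ = fun N => (count_upto (fun n =>
      j%:R / M%:R <= sval (x n) < j.+1%:R / M%:R) N)%:R / N%:R).
    apply: xud.
    - by rewrite divr_ge0.
    - by rewrite ltr_pM2r ?invr_gt0// ltr_nat.
    - by rewrite ler_pdivrMr// mul1r ler_nat.
  by apply/funext => N; rewrite mean_count_upto.
near=> N.
apply: (@le_trans _ _ (mean (fun=> e) N)); last first.
  by rewrite mean_cst//; near: N; exists 1%N.
apply: ler_mean => n _.
have x01 := svalP (x n).
rewrite -[cos _]mulr1 -[X in cos _ * X](@sum_arc M _ isT x01) mulr_sumr -sumrB.
rewrite -[leRHS]mulr1 -[X in _ <= _ * X](@sum_arc M _ isT x01) mulr_sumr.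
apply: le_trans (ler_norm_sum _ _ _) _; apply: ler_sum => j _.
rewrite -/(A j n) -mulrBl normrM (@ger0_norm _ (A j n)); last exact: ler0n.
rewrite /A /arc; case: (boolP (_ <= _ < _)) => [/andP[x1 x2]|_];
  last by rewrite !mulr0.
rewrite !mulr1 (le_trans _ wM)// (le_trans (cos_lipschitz _ _))//.
rewrite (_ : _ - _ = w * (sval (x n) - j%:R / M%:R)); last by rewrite /w; ring.
rewrite normrM (gtr0_norm w0) ger0_norm ?subr_ge0// ler_pM2l//.
by move: x2; rewrite -natr1 mulrDl mul1r => x2; lra.
Unshelve. all: by end_near. Qed.

End Arcs.

(** * Weyl's criterion: sufficiency *)

Section Kernel.
Variable R : realType.
Implicit Types (a b c y t phi : R).

(** The real part of the binomial expansion of (e^(it) + e^(-it))^n. *)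
Lemma expr_cos n t :
  (2 * cos t) ^+ n = \sum_(k < n.+1) 'C(n, k)%:R * cos ((k%:R *+ 2 - n%:R) * t).
Proof.
elim: n => [|n IH].
  by rewrite expr0 big_ord1 bin0 mul0rn subr0 mul0r cos0 mulr1.
rewrite exprS IH mulr_sumr.
rewrite (eq_bigr (fun k : 'I_n.+1 =>
   'C(n, k)%:R * cos ((k.+1%:R *+ 2 - n.+1%:R) * t) +
   'C(n, k)%:R * cos ((k%:R *+ 2 - n.+1%:R) * t))); last first.
  move=> k _; rewrite mulrCA cosM2 -mulrDr; congr (_ * (cos _ + _)).
    by rewrite -!natr1; ring.
  by rewrite -cosN; congr cos; rewrite -!natr1; ring.
rewrite big_split/= [in RHS]big_ord_recl.
rewrite [X in _ + X = _]big_ord_recl [X in _ + (_ + X) = _](_ : _ =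
   \sum_(k < n.+1) 'C(n, k.+1)%:R * cos ((k.+1%:R *+ 2 - n.+1%:R) * t)).
  rewrite addrCA -big_split/= !bin0; congr (_ + _).
  apply: eq_bigr => k _; rewrite /bump/= add1n binS natrD; ring.
by rewrite [RHS]big_ord_recr/= bin_small// mul0r addr0.
Qed.

Definition kernel (m : nat) t : R := ((1 + cos t) / 2) ^+ m.

(** The mean value of the kernel over a period; see [kernelE]. *)
Definition kernel_mass (m : nat) : R := 'C(m.*2, m)%:R / 4 ^+ m.

Lemma half_succ_cos_ge0 t : 0 <= (1 + cos t) / 2.
Proof. by rewrite divr_ge0// addrC -lerBlDr sub0r cos_geN1. Qed.

Lemma kernel_ge0 m t : 0 <= kernel m t.
Proof. by rewrite exprn_ge0// half_succ_cos_ge0. Qed.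

(** As (1 + cos t) / 2 = cos (t/2)^2, the kernel is a power of a cosine.  The
    frequencies k - m are written as distances because Weyl's criterion only
    speaks of positive ones. *)
Lemma kernelE m t : kernel m t = kernel_mass m +
  \sum_(k < m.*2.+1 | k != m :> nat)
    'C(m.*2, k)%:R / 4 ^+ m * cos ((maxn k m - minn k m)%:R * t).
Proof.
have -> : kernel m t = (2 * cos (t / 2)) ^+ m.*2 / 4 ^+ m.
  rewrite -muln2 mulnC exprM -expr_div_n /kernel; congr (_ ^+ _).
  rewrite {1}(_ : t = (t / 2) *+ 2); last by rewrite -mulr_natr; field.
  by rewrite cos_mulr2n; field.
have mm : (m < m.*2.+1)%N by rewrite ltnS -addnn leq_addr.
rewrite expr_cos (bigD1 (Ordinal mm))//= mulrDl; congr (_ + _).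
  rewrite [X in cos (X * _)](_ : _ = 0) ?mul0r ?cos0 ?mulr1//.
  by rewrite -[m.*2]muln2 natrM -[m%:R *+ 2]mulr_natr subrr.
rewrite mulr_suml; apply: eq_big => [k|k _]; first by rewrite -val_eqE.
rewrite mulrAC; congr (_ * _).
have -> : (k%:R *+ 2 - m.*2%:R) * (t / 2) = (k%:R - m%:R) * t.
  have -> : m.*2%:R = m%:R *+ 2 :> R by rewrite -muln2 natrM mulr_natr.
  by field.
have [km|mk] := leqP k m; last by rewrite natrB// ltnW.
by rewrite natrB// -cosN -mulNr opprB.
Qed.

Lemma kernel_dist_gt0 (k m : nat) : k != m -> (0 < maxn k m - minn k m)%N.
Proof. by rewrite subn_gt0 neq_ltn; case: ltngtP. Qed.

Lemma kernel_dist_le (k m : nat) :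
  (k <= m.*2)%N -> (maxn k m - minn k m <= m)%N.
Proof.
case: (leqP k m) => km; first by rewrite leq_subr.
by rewrite leq_subLR addnn.
Qed.

(** The grid has m + 1 points, more than the degree of the kernel, so it sees
    only the constant term. *)
Lemma sum_kernel_grid m y :
  \sum_(0 <= i < m.+1) kernel m (2 * pi * (y - i%:R / m.+1%:R)) =
  m.+1%:R * kernel_mass m.
Proof.
under eq_bigr do rewrite kernelE.
rewrite big_split/= sumr_const_nat subn0 -[X in X + _]mulr_natl.
rewrite exchange_big/= big1 ?addr0// => k km; rewrite -mulr_sumr.
set d := (_ - _)%N.
have d0 : (0 < d)%N by exact: kernel_dist_gt0.
have dm : (d < m.+1)%N by rewrite ltnS kernel_dist_le// -ltnS.
rewrite (eq_bigr (fun i : nat =>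
    cos (2 * pi * d%:R / m.+1%:R * i%:R + - (2 * pi * d%:R * y)))).
  by rewrite sum_cos_roots ?mulr0// d0.
by move=> i _; rewrite -cosN; congr cos; ring.
Qed.

(** The value 1 of the kernel at 0 is one of the nonnegative terms of the grid
    sum: this bounds the mass below without estimating the central binomial
    coefficient. *)
Lemma kernel_mass_ge m : 1 <= m.+1%:R * kernel_mass m.
Proof.
rewrite -(sum_kernel_grid m 0) big_nat_recl//= mul0r subrr mulr0.
rewrite {1}/kernel cos0 divff ?expr1n// lerDl.
by apply: sumr_ge0 => i _; exact: kernel_ge0.
Qed.

(** With s = sqrt r, the factor (n + 1) s^n is at most 1 + s + ... + s^n, hence
    bounded, and the remaining factor s^n tends to 0. *)
Lemma cvg_succ_mul_expr (r : R) : 0 <= r < 1 ->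
  (fun n => n.+1%:R * r ^+ n) @ \oo --> (0 : R).
Proof.
move=> /andP[r0 r1]; pose s : R := Num.sqrt r.
have s0 : 0 <= s by exact: sqrtr_ge0.
have s1 : s < 1 by rewrite -[1]sqrtr1 ltr_sqrt.
have rE : r = s ^+ 2 by rewrite sqr_sqrtr.
have bnd n : n.+1%:R * s ^+ n <= (1 - s)^-1.
  rewrite -[leRHS]mul1r ler_pdivlMr ?subr_gt0//.
  apply: (@le_trans _ _ ((1 - s) * \sum_(i < n.+1) s ^+ i)); last first.
    by rewrite -opprB mulNr -subrX1 opprB gerBl exprn_ge0.
  rewrite mulrC ler_pM2l ?subr_gt0// mulr_natl.
  rewrite -[n.+1 in leLHS]card_ord -sumr_const.
  apply: ler_sum => i _; apply: (ler_wiXn2l s0 (ltW s1)).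
  by rewrite -ltnS.
apply: (@squeeze_cvgr _ _ _ _ (fun=> 0) (fun n => (1 - s)^-1 * s ^+ n)).
- near=> n; rewrite mulr_ge0 ?exprn_ge0//= rE -exprM mulnC exprM expr2 mulrA.
  by rewrite ler_wpM2r ?exprn_ge0.
- exact: cvg_cst.
- rewrite -[X in _ --> X](mulr0 (1 - s)^-1); apply: cvgMl_tmp.
  by apply: cvg_expr; rewrite ger0_norm.
Unshelve. all: by end_near. Qed.

Lemma cos_far (d z : R) : 0 <= d -> d <= z -> z <= 1 - d ->
  cos (2 * pi * z) <= cos (2 * pi * d).
Proof.
have mono (y : R) : 0 <= d -> d <= y -> y <= 1 / 2 ->
    cos (2 * pi * y) <= cos (2 * pi * d).
  move=> d0 dy y2; have p0 := pi_gt0 R.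
  have H (v : R) : 0 <= v -> v <= 1 / 2 -> 2 * pi * v \in `[0, pi : R].
    by move=> v0 v2; rewrite in_itv/=; apply/andP; split; nra.
  rewrite leNgt ltr_cos ?H ?(le_trans d0)// ?(le_trans dy)// -leNgt.
  by rewrite ler_pM2l// mulr_gt0.
move=> d0 dz zd; have [z2|z2] := leP z (1 / 2); first exact: mono.
rewrite -cosN -(cosDnat _ 1) (_ : - _ + _ = 2 * pi * (1 - z)); last by ring.
by apply: mono => //; lra.
Qed.

(** The majorant of the arc [a, b) is T + d, where T sums the normalized kernel
    over L = floor (M (b - a + 2d)) + 1 consecutive points of the grid of step 1/M
    starting at a - d, so that the points left out lie beyond b + d.  Summed
    over all M grid points the normalized kernel gives 1, and for y in [a, b)
    the points left out are at distance at least d from y modulo 1, so their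
    contribution is at most M r^m <= d.  The mean value of T along x is
    L / M, close to b - a. *)
Lemma weyl_arc_upper (x : nat -> R) (a b e : R) :
  (forall (h : nat) phi, (0 < h)%N ->
    mean (fun n => cos (2 * pi * h%:R * x n + phi)) @ \oo --> (0 : R)) ->
  a <= b -> 0 < e ->
  \forall N \near \oo, mean (fun n => arc a b (x n)) N <= b - a + e.
Proof.
move=> xw ab e0.
have [big|small] := leP 1 (b - a + e).
  near=> N; apply: le_trans big.
  rewrite -[leRHS](@mean_cst _ _ N); last by near: N; exists 1%N.
  by apply: ler_mean => n _; rewrite /arc lern1 leq_b1.
(* Enlarging the arc costs 2d, rounding L costs 1/M <= d, the omitted points
   cost d and passing to the limit costs d. *)
pose d : R := e / 5.
have d0 : 0 < d by rewrite divr_gt0.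
have de : e = d * 5 by rewrite /d; field.
pose r : R := (1 + cos (2 * pi * d)) / 2.
have r0 : 0 <= r by exact: half_succ_cos_ge0.
have r1 : r < 1.
  rewrite ltr_pdivrMr// mul1r -ltrBrDl.
  rewrite (_ : 2 - 1 = cos 0); last by rewrite cos0; ring.
  have p0 := pi_gt0 R.
  rewrite ltr_cos ?in_itv/= ?lexx ?pi_ge0//; first by nra.
  by apply/andP; split; nra.
have [m [mr dm]] : exists m : nat, m.+1%:R * r ^+ m <= d /\ 1 <= m.+1%:R * d.
  near \oo => m; exists m; split.
    by near: m; apply: cvgr_le d0; apply: cvg_succ_mul_expr; rewrite r0 r1.
  rewrite -ler_pdivrMr//; near: m.
  near=> m; rewrite (@le_trans _ _ m%:R)// ?ler_nat//.
  by near: m; exact: nbhs_infty_ger.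
set M := m.+1 in mr dm.
have M0 : 0 < M%:R :> R by rewrite ltr0n.
pose L := (Num.truncn (M%:R * (b - a + d * 2))).+1.
have LM1 : M%:R * (b - a + d * 2) < L%:R by exact: truncnS_gt.
have LM2 : L%:R <= M%:R * (b - a + d * 2) + 1.
  by rewrite /L -natr1 lerD2r truncn_le; nra.
have LM : (L <= M)%N.
  rewrite -(ler_nat R) (le_trans LM2)//.
  suff : 0 <= M%:R * (1 - (b - a + d * 5)) by move: dm; nra.
  by rewrite mulr_ge0 ?subr_ge0// -de ltW.
pose c := a - d.
pose k := kernel_mass m.
have k1 : 1 <= M%:R * k by exact: kernel_mass_ge.
pose T y := (M%:R * k)^-1 *
  \sum_(0 <= i < L) kernel m (2 * pi * (y - c - i%:R / M%:R)).
have T0 y : 0 <= T y.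
  rewrite mulr_ge0 ?invr_ge0 ?(le_trans _ k1)//.
  by apply: sumr_ge0 => i _; exact: kernel_ge0.
have T1 y : arc a b y <= T y + d.
  rewrite /arc; case: (boolP (_ <= _ < _)) => [/andP[ay yb]|_]; last first.
    by rewrite addr_ge0// ltW.
  rewrite mulr1n; suff : T y >= 1 - M%:R * r ^+ m by lra.
  have := sum_kernel_grid m (y - c); rewrite -/M -/k.
  rewrite (big_cat_nat (leq0n L) LM)/= => sE.
  have -> : T y = 1 - (M%:R * k)^-1 *
      \sum_(L <= i < M) kernel m (2 * pi * (y - c - i%:R / M%:R)).
    have Mk0 : M%:R * k != 0 by rewrite gt_eqF// (lt_le_trans _ k1).
    by apply: (mulfI Mk0); rewrite mulrBr mulr1 !mulVKf// -sE addrK.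
  rewrite lerD2l lerN2 ler_pdivrMl ?(lt_le_trans _ k1)//.
  apply: (@le_trans _ _ (M%:R * r ^+ m)); last first.
    by rewrite ler_peMl// mulr_ge0// exprn_ge0.
  apply: (@le_trans _ _ (\sum_(L <= i < M) r ^+ m)); last first.
    rewrite sumr_const_nat -[X in X <= _]mulr_natl ler_wpM2r ?exprn_ge0//.
    by rewrite ler_nat leq_subr.
  rewrite !big_nat; apply: ler_sum => i /andP[Li iM].
  have iM1 : i%:R / M%:R <= 1 :> R by rewrite ler_pdivrMr// mul1r ler_nat ltnW.
  have iM2 : b - a + d * 2 <= i%:R / M%:R.
    rewrite ler_pdivlMr// mulrC (le_trans (ltW LM1))// ler_nat//.
  apply: lerXn2r; [exact: half_succ_cos_ge0|exact: r0|].
  rewrite ler_pM2r ?invr_gt0// lerD2l -cosN -mulrN.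
  by apply: cos_far; rewrite /c; lra.
have Tlim : mean (fun n => T (x n)) @ \oo --> (L%:R / M%:R : R).
  rewrite meanZ.
  have -> : L%:R / M%:R = (M%:R * k)^-1 * (L%:R * k).
    by field; rewrite !gt_eqF//; nra.
  apply: cvgMl_tmp.
  under [X in mean X]eq_fun do rewrite big_mkord.
  have -> : L%:R * k = \sum_(i < L) k by rewrite sumr_const card_ord mulr_natl.
  rewrite mean_sum.
  apply: cvg_sum_fin => i _.
  under [X in mean X]eq_fun do rewrite kernelE.
  rewrite meanD -[k]addr0; apply: cvgD; first exact: cvg_mean_cst.
  rewrite mean_sum.
  rewrite [X in _ --> X](_ : 0 = \sum_(k < m.*2.+1 | k != m :> nat) 0);
    last by rewrite big1.
  apply: cvg_sum_fin => j jm; rewrite meanZ.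
  rewrite -[X in _ --> X](mulr0 ('C(m.*2, j)%:R / 4 ^+ m)); apply: cvgMl_tmp.
  have := xw _ (- (maxn j m - minn j m)%:R * (2 * pi * (c + i%:R / M%:R)))
    (kernel_dist_gt0 jm).
  set d' := (_ - _)%N.
  rewrite (_ : (fun n => _) =
    (fun n => cos (d'%:R * (2 * pi * (x n - c - i%:R / M%:R)))))//.
  by apply/funext => n; congr cos; ring.
near=> N.
apply: (@le_trans _ _ (mean (fun n => T (x n)) N + d)).
  rewrite -[X in _ + X](@mean_cst _ _ N); last by near: N; exists 1%N.
  have := meanD (fun n => T (x n)) (fun=> d) => /(congr1 (@^~ N))/= <-.
  exact: ler_mean.
have : mean (fun n => T (x n)) N <= L%:R / M%:R + d.
  by near: N; apply: cvgr_le Tlim _ _; rewrite ltrDl.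
have : L%:R / M%:R <= b - a + d * 3.
  by rewrite ler_pdivrMr//; nra.
lra.
Unshelve. all: by end_near. Qed.

(** The upper bounds for [0, a), [a, b) and [b, 1), whose frequencies add up to
    1, together give the lower bound for [a, b). *)
Lemma weyl_sufficient (x : nat -> circle R) :
  (forall (h : nat) phi, (0 < h)%N ->
    mean (fun n => cos (2 * pi * h%:R * sval (x n) + phi)) @ \oo --> (0 : R)) ->
  uniformly_distributed x.
Proof.
move=> xw a b a0 ab b1.
apply/cvgrPdist_le => e e0.
have e2 : 0 < e / 2 by rewrite divr_gt0.
have up a' b' (h : a' <= b') := weyl_arc_upper xw h e2.
near=> N; rewrite mean_count_upto.
have N0 : (0 < N)%N by near: N; exists 1%N.
have h1 : mean (fun n => arc 0 a (sval (x n))) N <= a - 0 + e / 2.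
  by near: N; exact: up.
have h2 : mean (fun n => arc a b (sval (x n))) N <= b - a + e / 2.
  by near: N; apply: up; exact: ltW.
have h3 : mean (fun n => arc b 1 (sval (x n))) N <= 1 - b + e / 2.
  by near: N; exact: up.
have : mean (fun n => arc 0 a (sval (x n)) + arc a b (sval (x n))
   + arc b 1 (sval (x n))) N = 1.
  rewrite -[RHS](@mean_cst _ 1 N)//; congr (_ N); apply: eq_mean => n _.
  have /andP[y0 y1] := svalP (x n).
  by rewrite !arcE// ?ltW// y1 (ltNge (sval (x n)) 0) y0/=; ring.
rewrite !meanD/= => h4; rewrite ler_norml;
  apply/andP; split; rewrite /arc in h1 h2 h3 h4 *; lra.
Unshelve. all: by end_near. Qed.

End Kernel.

(** * Approximation in mean by cosines with rational frequencies *)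

Section Approximation.
Variable R : realType.
Implicit Types (F : nat -> R) (v : nat -> R).

Lemma limn_esup_lt_near v (e : R) :
  (limn_esup (fun N => (v N)%:E) < e%:E)%E -> \forall N \near \oo, v N <= e.
Proof.
move=> /ereal_inf_lt[_ [V /= V_oo <-] Ve]; apply: filterS V_oo => N VN.
rewrite -lee_fin; apply: le_trans (ltW Ve).
by apply: ereal_sup_ubound; exists N.
Qed.

Lemma lt_limn_esup_frequently v (e : R) (V : set nat) :
  (e%:E < limn_esup (fun N => (v N)%:E))%E -> (\forall N \near \oo, V N) ->
  exists2 N, V N & e < v N.
Proof.
move=> ev V_oo.
have : (e%:E < ereal_sup [set (v N)%:E | N in V])%E.
  by apply: lt_le_trans ev _; apply: ereal_inf_lbound; exists V.
by move=> /ereal_sup_gt[_ [N VN <-]]; rewrite lte_fin; exists N.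
Qed.

Definition rational_cos_sum (I : finType) (w : I -> R) (q : I -> rat)
    (phi : I -> R) (n : nat) : R :=
  \sum_i w i * cos (2 * pi * ratr (q i) * n%:R + phi i).

(** The real counterpart of [rational_Besicovitch_ap]. *)
Definition rational_cos_approximable F := forall e : R, 0 < e ->
  exists (I : finType) (w : I -> R) (q : I -> rat) (phi : I -> R),
    \forall N \near \oo,
      mean (fun n => `|F n - rational_cos_sum w q phi n|) N <= e.

Lemma ler_Re_normc (z : R[i]) : `|complex.Re z| <= Normc.normc z.
Proof.
by case: z => a b /=; rewrite -sqrtr_sqr ler_wsqrtr// lerDl sqr_ge0.
Qed.

(** Each c e^(i t) contributes Re c cos t - Im c sin t, and
    - sin t = cos (t + pi/2); the boolean index separates the two terms. *)
Lemma Re_rational_trig_poly (k : nat) (c : 'I_k -> R[i]) (alpha : 'I_k -> rat)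
    n :
  complex.Re (rational_trig_poly c alpha n) =
  rational_cos_sum
    (fun i : 'I_k * bool =>
      if i.2 then complex.Im (c i.1) else complex.Re (c i.1))
    (fun i => alpha i.1) (fun i => if i.2 then pi / 2 else 0) n.
Proof.
rewrite /rational_cos_sum -(pair_bigA _ (fun j (b : bool) =>
  (if b then complex.Im (c j) else complex.Re (c j)) *
  cos (2 * pi * ratr (alpha j) * n%:R + (if b then pi / 2 else 0))))/=.
rewrite /rational_trig_poly raddf_sum; apply: eq_bigr => j _.
rewrite big_bool/= cosDpihalf addr0 /expi.
by case: (c j) => x y /=; ring.
Qed.

Lemma rational_Besicovitch_cos_approximable F :
  rational_Besicovitch_ap (fun n => (F n)%:C%C) -> rational_cos_approximable F.
Proof.
move=> h e /h [k [_ [alpha [c /limn_esup_lt_near ce]]]].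
exists ('I_k * bool)%type,
  (fun i => if i.2 then complex.Im (c i.1) else complex.Re (c i.1)),
  (fun i => alpha i.1), (fun i => if i.2 then pi / 2 else 0).
apply: filterS ce => N; apply: le_trans.
apply: ler_mean => n _; rewrite -Re_rational_trig_poly.
apply: le_trans (ler_Re_normc _).
by rewrite raddfB.
Qed.

Lemma is_cvg_mean_rational_cos_sum (I : finType) (w : I -> R) q phi :
  cvgn (mean (rational_cos_sum w q phi)).
Proof.
rewrite /rational_cos_sum mean_sum; apply/cvgP/cvg_sum_fin => i _.
by rewrite meanZ; apply: cvgMl_tmp; apply: is_cvg_mean_cos.
Qed.

(** A cosine sum close to F in mean has a mean value, so the averages of F
    eventually stay in a small interval, which contains values above D. *)
Lemma mean_eventually_ge F (D : R) : rational_cos_approximable F -> 0 < D ->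
  (D%:E < limn_esup (fun N => (mean F N)%:E))%E ->
  \forall N \near \oo, D / 2 <= mean F N.
Proof.
move=> Fap D0 FD; pose e := D / 8.
have e0 : 0 < e by rewrite divr_gt0.
have De : D = e * 8 by rewrite /e; field.
have [I [w [q [phi Pe]]]] := Fap e e0.
set P := rational_cos_sum w q phi in Pe.
have /cvg_ex[l /cvgrPdist_le/(_ e e0) Pl] : cvgn (mean P).
  exact: is_cvg_mean_rational_cos_sum.
have Fl : \forall N \near \oo, `|l - mean F N| <= e * 2.
  near=> N.
  have h1 : `|l - mean P N| <= e by near: N.
  have h2 : mean (fun n => `|F n - P n|) N <= e by near: N.
  have := le_trans (ler_norm_mean (fun n => F n - P n) N) h2.
  rewrite meanB/= => h3.
  move: h1 h3; rewrite !ler_norml => /andP[? ?] /andP[? ?].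
  by apply/andP; split; lra.
have [N0 + FN0] := lt_limn_esup_frequently FD Fl.
rewrite ler_norml => /andP[? ?].
by apply: filterS Fl => N; rewrite ler_norml => /andP[? ?]; lra.
Unshelve. all: by end_near. Qed.

End Approximation.

(** * Orthogonality of h u(n) to rational frequencies *)

Section Twisted.
Variable R : realType.
Variable u : nat -> circle R.

(** The frequency q / h turns into q after multiplication by h. *)
Lemma cvg_mean_twisted (q : rat) (h : nat) (phi : R) :
  (forall alpha : rat,
      uniformly_distributed (fun n => u n + to_circle (n%:R * ratr alpha))) ->
  (0 < h)%N ->
  mean (fun n =>
    cos (2 * pi * h%:R * sval (u n) + 2 * pi * ratr q * n%:R + phi))
    @ \oo --> (0 : R).
Proof.
move=> hu h0.
have := weyl_necessary phi (hu (q / h%:R)) h0.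
rewrite (@eq_mean _ _ (fun n =>
  cos (2 * pi * h%:R * sval (u n) + 2 * pi * ratr q * n%:R + phi)))// => n _.
rewrite [u n + _]/(to_circle
  (sval (u n) + sval (to_circle (n%:R * ratr (q / h%:R))))).
rewrite !sval_to_circle.
(* m1 and m2 are the integers added by the two reductions modulo 1. *)
set m1 := (- _)%Z; set m2 := (- _)%Z.
rewrite -[RHS](cosDint _ (h%:Z * (m1 + m2))); congr cos.
rewrite intrM intrD fmorph_div/= ratr_nat -pmulrn.
by field; rewrite pnatr_eq0 -lt0n.
Qed.

(** By [cvg_mean_approx] F may be replaced by a sum of cosines; the product of
    two cosines is then a sum of two, with frequencies q and - q. *)
Lemma cvg_mean_mul_approximable (F : nat -> R) (h : nat) (phi : R) :
  (forall alpha : rat,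
      uniformly_distributed (fun n => u n + to_circle (n%:R * ratr alpha))) ->
  rational_cos_approximable F -> (0 < h)%N ->
  mean (fun n => cos (2 * pi * h%:R * sval (u n) + phi) * F n)
    @ \oo --> (0 : R).
Proof.
move=> hu Fap h0; apply: cvg_mean_approx => e /Fap[I [w [q [psi Pe]]]].
pose g n := cos (2 * pi * h%:R * sval (u n) + phi).
exists (fun n => g n * rational_cos_sum w q psi n); split; last first.
  apply: filterS Pe => N; apply: le_trans; apply: ler_mean => n _.
  by rewrite -/(g n) -mulrBr normrM ler_piMl// cos_max.
rewrite (@eq_mean _ _ (fun n => \sum_i g n *
  (w i * cos (2 * pi * ratr (q i) * n%:R + psi i)))); last first.
  by move=> n _; rewrite mulr_sumr.
rewrite mean_sum [X in _ --> X](_ : 0 = \sum_(i : I) 0); last by rewrite big1.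
apply: cvg_sum_fin => i _.
rewrite (@eq_mean _ _ (fun n => w i / 2 *
  (cos (2 * pi * h%:R * sval (u n) + 2 * pi * ratr (q i) * n%:R
    + (phi + psi i)) +
   cos (2 * pi * h%:R * sval (u n) + 2 * pi * ratr (- q i) * n%:R
    + (phi - psi i))))).
  rewrite meanZ meanD -[X in _ --> X](mulr0 (w i / 2)); apply: cvgMl_tmp.
  rewrite -[X in _ --> X]addr0.
  by apply: cvgD; apply: cvg_mean_twisted.
move=> n _; set x := 2 * pi * h%:R * _; set y := 2 * pi * _ * _.
have -> : 2 * pi * ratr (- q i) * n%:R = - y :> R by rewrite rmorphN /y; ring.
have := cosM2 (x + phi) (y + psi i).
have -> : x + phi + (y + psi i) = x + y + (phi + psi i) by ring.
have -> : x + phi - (y + psi i) = x - y + (phi - psi i) by ring.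
by move=> <-; rewrite /g -/x; field.
Qed.

End Twisted.

(** * Averages along a subsequence of positive lower density *)

Section Subsequence.
Variable R : realType.
Variable nk : nat -> nat.
Hypothesis nk_gt0 : forall k, (0 < k)%N -> (0 < nk k)%N.
Hypothesis nk_incr : forall j k, (0 < j)%N -> (j < k)%N -> (nk j < nk k)%N.

Lemma leq_incr k : (k <= nk k)%N.
Proof.
elim: k => [//|[|k] IH]; first exact: nk_gt0.
exact: leq_ltn_trans IH (nk_incr _ _).
Qed.

Lemma perm_seq_range K : (0 < K)%N ->
  perm_eq [seq n <- index_iota 1 (nk K).+1 | n \in seq_range nk]
          [seq nk k | k <- index_iota 1 K.+1].
Proof.
move=> K0.
have nk_lt j k : (0 < j)%N -> (0 < k)%N -> (nk j <= nk k)%N -> (j <= k)%N.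
  move=> j0 k0; apply: contraTT; rewrite -!ltnNge => kj; exact: nk_incr.
apply: uniq_perm.
- by rewrite filter_uniq// iota_uniq.
- rewrite map_inj_in_uniq ?iota_uniq// => j k.
  rewrite !mem_index_iota => /andP[j0 _] /andP[k0 _] jk.
  apply/eqP; rewrite eqn_leq; apply/andP.
  by split; apply: nk_lt; rewrite ?j0 ?k0 ?jk.
move=> n; rewrite mem_filter mem_index_iota; apply/idP/mapP.
- move=> /andP[/set_mem[k /= k0 <-] /andP[_ kK]]; exists k => //.
  by rewrite mem_index_iota k0 ltnS nk_lt.
- move=> [k]; rewrite mem_index_iota => /andP[k0 kK] ->.
  rewrite nk_gt0// ltnS; apply/andP; split; first by apply/mem_set; exists k.
  have [-> | kneK] := eqVneq k K; first exact: leqnn.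
  by apply: ltnW; apply: nk_incr; rewrite // ltn_neqAle kneK -ltnS.
Qed.

Lemma sum_seq_range (g : nat -> R) K : (0 < K)%N ->
  \sum_(1 <= n < (nk K).+1) g n * \1_(seq_range nk) n =
  \sum_(1 <= k < K.+1) g (nk k).
Proof.
move=> K0; rewrite -[RHS](big_map nk xpredT g).
rewrite -(perm_big _ (perm_seq_range K0)).
rewrite big_filter [RHS]big_mkcond; apply: eq_bigr => n _.
by rewrite indicE; case: (n \in _); rewrite ?mulr1 ?mulr0.
Qed.

(** Up to n_K the set {n_k} has K elements, so the average of g along it is the
    average of g times its indicator, divided by its density, at n_K. *)
Lemma cvg_mean_subseq (g : nat -> R) (D : R) : 0 < D ->
  (\forall N \near \oo, D <= mean (\1_(seq_range nk) : nat -> R) N) ->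
  mean (fun n => g n * \1_(seq_range nk) n) @ \oo --> (0 : R) ->
  mean (fun k => g (nk k)) @ \oo --> (0 : R).
Proof.
move=> D0 dens gA.
have nk_oo : nk @ \oo --> \oo.
  move=> V [N _ NV]; exists N => // k /= Nk; apply: NV => /=.
  exact: leq_trans Nk (leq_incr k).
apply/norm_cvg0P.
apply: (@squeeze_cvgr _ _ _ _ (fun=> 0)
  (fun K => D^-1 * `|mean (fun n => g n * \1_(seq_range nk) n) (nk K)|)).
- near=> K; rewrite normr_ge0/=.
  have K0 : (0 < K)%N by near: K; exists 1%N.
  have nK0 : (nk K)%:R != 0 :> R by rewrite pnatr_eq0 -lt0n nk_gt0.
  have DK : D <= mean (\1_(seq_range nk) : nat -> R) (nk K).
    by near: K; exact: nk_oo dens.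
  rewrite ler_pdivlMl// [in leRHS]/mean sum_seq_range//.
  have -> : (\sum_(1 <= k < K.+1) g (nk k)) / (nk K)%:R =
      mean (\1_(seq_range nk) : nat -> R) (nk K) * mean (fun k => g (nk k)) K.
    rewrite /mean.
    have -> : \sum_(1 <= n < (nk K).+1) \1_(seq_range nk) n = K%:R :> R.
      under eq_bigr do rewrite -[\1_ _ _]mul1r.
      by rewrite (sum_seq_range (fun=> 1)) // sumr_const_nat subn1.
    by field; rewrite nK0 andbT pnatr_eq0 -lt0n.
  rewrite [leRHS]normrM ler_wpM2r//.
  by apply: le_trans DK (ler_norm _).
- exact: cvg_cst.
- rewrite -[X in _ --> X](mulr0 D^-1); apply: cvgMl_tmp.
  exact: (cvg_comp nk (fun N => `|mean _ N|) nk_oo ((norm_cvg0P _).2 gA)).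
Unshelve. all: by end_near. Qed.

End Subsequence.

(** * Uniform distribution along rational Besicovitch sequences *)

Theorem theorem4p9 (R : realType) (u : nat -> circle R) (nk : nat -> nat)
    (hu : forall alpha : rat,
      uniformly_distributed (fun n => u n + to_circle (n%:R * ratr alpha)))
    (hnk : rational_Besicovitch_seq R nk) :
  uniformly_distributed (fun k => u (nk k)).
Proof.
have [nk_gt0 nk_incr /rational_Besicovitch_cos_approximable Aap dens] := hnk.
have [D D0 DA] : exists2 D : R, 0 < D &
    \forall N \near \oo, D <= mean (\1_(seq_range nk) : nat -> R) N.
  have dE : upper_density R (seq_range nk) =
      limn_esup (fun N => (mean (\1_(seq_range nk) : nat -> R) N)%:E).
    rewrite /upper_density; congr limn_esup; apply/funext => N.
    by rewrite mean_count_upto.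
  have [D D0 Dd] : exists2 D : R, 0 < D &
      (D%:E < upper_density R (seq_range nk))%E.
    move: dens; case: (upper_density _ _) => [r| |//].
    - rewrite lte_fin => r0; exists (r / 2); first by rewrite divr_gt0.
      by rewrite lte_fin; lra.
    - by exists 1 => //; rewrite ltry.
  exists (D / 2); first by rewrite divr_gt0.
  by apply: mean_eventually_ge => //; rewrite -dE.
apply: weyl_sufficient => h phi h0.
apply: (cvg_mean_subseq nk_gt0 nk_incr
  (g := fun n => cos (2 * pi * h%:R * sval (u n) + phi)) D0 DA).
exact: cvg_mean_mul_approximable.
Qed.
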